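(* Consider the online selection problem with $C\ge1$ units and valuations in $[L,U]$, $0<L\le U$, $\theta=U/L$. No online algorithm, including deterministic and randomized algorithms, can achieve a competitive ratio smaller than $1+\ln\theta$.
   Context: Online selection problem: a seller has $C$ identical units of an item. Buyers $n=1,\dots,N$ arrive one at a time; buyer $n$ has a private valuation $v_n\in[L,U]$. An instance is $I=(v_1,\dots,v_N)$, with $N$ arbitrary, and $N$ and the valuations unknown in advance. On arrival of buyer $n$ a price $p_n$ is posted; buyer $n$ buys one unit ($x_n=1$) if $v_n\ge p_n$ and fewer than $C$ units have been sold so far, otherwise $x_n=0$; decisions are irrevocable. A deterministic online algorithm determines $p_n$ as a function of the past decisions $x_1,\dots,x_{n-1}$ only; a randomized online algorithm is a probability distribution over deterministic ones. The social welfare is $\sum_n v_nx_n$; $\mathrm{ALG}(I)$ denotes that of the algorithm, and $\mathrm{OPT}(I)$ is the sum of the $\min\{C,N\}$ largest valuations. The competitive ratio is $\sup_I\mathrm{OPT}(I)/\mathbb{E}[\mathrm{ALG}(I)]$, with expectation over the algorithm's randomness. *)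

(* Defs.v *)
From HB Require Import structures.
From mathcomp Require Import all_boot all_order all_algebra.
From mathcomp Require Import all_classical all_reals all_analysis.

Set Implicit Arguments.
Unset Strict Implicit.
Unset Printing Implicit Defensive.

Import Order.TTheory GRing.Theory Num.Theory.

Local Open Scope classical_set_scope.
Local Open Scope ring_scope.

(* Maps the past decisions, in chronological order (true = a unit was sold),
   to the price posted next; the length of the history determines the index
   of the arriving buyer. *)
Definition det_algorithm (R : realType) := seq bool -> R.

(* An instance is the sequence of valuations. The empty instance is excluded,
   as its ratio would be 0 / 0. *)
Definition instances (R : realType) (L U : R) : set (seq R) :=
  [set I | I != [::] /\ {in I, forall v, L <= v <= U}].

Definition decisions (R : realType) (C : nat) (p : det_algorithm R)
    (I : seq R) : seq bool :=
  foldl (fun x v => rcons x ((p x <= v) && (count id x < C)%N)) [::] I.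

Definition alg_welfare (R : realType) (C : nat) (p : det_algorithm R)
    (I : seq R) : R :=
  \sum_(n < size I) nth 0 I n * (nth false (decisions C p I) n)%:R.

Definition opt_welfare (R : realType) (C : nat) (I : seq R) : R :=
  \sum_(v <- take C (sort >=%R I)) v.

(* [W I] is the (expected) welfare of the algorithm on [I]. In [\bar R] the
   inverse of 0 is +oo, so an instance with zero expected welfare (and hence
   positive optimum, when 0 < C and 0 < L) contributes +oo. *)
Definition competitive_ratio (R : realType) (C : nat) (L U : R)
    (W : seq R -> \bar R) : \bar R :=
  ereal_sup [set ((opt_welfare C I)%:E / W I)%E | I in instances L U].

Definition det_competitive_ratio (R : realType) (C : nat) (L U : R)
    (p : det_algorithm R) : \bar R :=
  competitive_ratio C L U (fun I => (alg_welfare C p I)%:E).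

(* A probability distribution over deterministic algorithms is presented as a
   random element [A] on a probability space [P], measurable with respect to
   the product sigma-algebra on [seq bool -> R] (i.e. coordinatewise). *)
Definition random_algorithm (R : realType) (d : measure_display)
    (Omega : measurableType d) (A : Omega -> det_algorithm R) : Prop :=
  forall x : seq bool, measurable_fun setT (fun w => A w x).

Definition rand_competitive_ratio (R : realType) (d : measure_display)
    (Omega : measurableType d) (P : probability Omega R) (C : nat) (L U : R)
    (A : Omega -> det_algorithm R) : \bar R :=
  competitive_ratio C L U (fun I => 'E_P[fun w => alg_welfare C (A w) I])%E.

(* Main.v *)
(* Buyers arrive in batches of C with values L, L q, ..., L q^K, where
   q^K = U / L. On every run of the algorithm the number of units sold, at most
   C, is a fixed nonnegative combination of the welfares on the prefixes made of
   the first k + 1 batches, and this survives taking expectations. On such a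
   prefix the optimum is C L q^k, so a ratio a forces welfare at least C L q^k / a;
   substituting gives a >= 1 + K (1 - 1/q), which tends to 1 + ln (U / L) as K
   tends to infinity. *)

Require Import Defs.
From mathcomp Require Import all_boot all_order all_algebra.
From mathcomp Require Import all_classical all_reals all_analysis.
From mathcomp Require Import ring lra.

Set Implicit Arguments.
Unset Strict Implicit.
Unset Printing Implicit Defensive.

Import Order.TTheory GRing.Theory Num.Theory.

Local Open Scope ring_scope.

(** * Units sold, welfare and optimum for a deterministic algorithm *)

Section Deterministic.
Variables (R : realType) (C : nat).
Implicit Types (p : det_algorithm R) (I s : seq R) (v : R).

Definition sold p I : nat := count id (decisions C p I).

Lemma decisions_rcons p I v : decisions C p (rcons I v) =
  rcons (decisions C p I) ((p (decisions C p I) <= v) && (sold p I < C)%N).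
Proof. by rewrite /decisions foldl_rcons. Qed.

Lemma size_decisions p I : size (decisions C p I) = size I.
Proof.
by elim/last_ind: I => // I v ih; rewrite decisions_rcons !size_rcons ih.
Qed.

Lemma sold_rcons p I v : sold p (rcons I v) =
  (sold p I + ((p (decisions C p I) <= v)%R && (sold p I < C)))%N.
Proof. by rewrite /sold decisions_rcons -cats1 count_cat /= addn0. Qed.

Lemma sold_le p I : (sold p I <= C)%N.
Proof.
elim/last_ind: I => // I v ih; rewrite sold_rcons.
by case: ltnP => h; rewrite ?andbF ?addn0 //; case: (_ <= v); rewrite ?addn1 ?addn0.
Qed.

(** The difference of the two counts is the 0/1 decision on [v]; in this form the contributions of
    equal valuations telescope. *)
Lemma alg_welfare_rcons p I v : alg_welfare C p (rcons I v) =
  alg_welfare C p I + v * ((sold p (rcons I v))%:R - (sold p I)%:R).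
Proof.
rewrite {1}/alg_welfare size_rcons big_ord_recr /= decisions_rcons.
rewrite !nth_rcons size_decisions ltnn eqxx sold_rcons natrD addrAC subrr add0r.
congr (_ + _); apply: eq_bigr => i _.
by rewrite !nth_rcons size_decisions ltn_ord.
Qed.

Lemma alg_welfare_nseq p I v n : alg_welfare C p (I ++ nseq n v) =
  alg_welfare C p I + v * ((sold p (I ++ nseq n v))%:R - (sold p I)%:R).
Proof.
elim: n => [|n ih]; first by rewrite cats0 subrr mulr0 addr0.
rewrite -[n.+1]addn1 nseqD /= catA cats1 alg_welfare_rcons ih; ring.
Qed.

Lemma alg_welfare_ge0 p I : {in I, forall v, 0 <= v} -> 0 <= alg_welfare C p I.
Proof.
move=> I0; apply: sumr_ge0 => i _.
by rewrite mulr_ge0 // I0 // mem_nth.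
Qed.

(** The bound is uniform in [p], so on a fixed instance the welfare of a random algorithm is a
    bounded random variable. *)
Lemma alg_welfare_norm_le p I :
  `|alg_welfare C p I| <= \sum_(n < size I) `|nth 0 I n|.
Proof.
apply: le_trans (ler_norm_sum _ _ _) _; apply: ler_sum => i _.
by rewrite normrM ler_piMr // normr_nat; case: nth.
Qed.

(** Sorting in decreasing order moves the final block, whose [C] entries dominate [s], to the front,
    where [take C] selects exactly it. *)
Lemma opt_welfare_cat_nseq s v : {in s, forall u, u <= v} ->
  opt_welfare C (s ++ nseq C v) = C%:R * v.
Proof.
move=> sv; rewrite /opt_welfare.
suff -> : sort >=%R (s ++ nseq C v) = nseq C v ++ sort >=%R s.
  by rewrite take_size_cat ?size_nseq // big_nseq iter_addr addr0 mulr_natl.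
apply: (@sorted_eq _ >=%R).
- exact: ge_trans.
- by move=> x y /le_anti.
- by apply: sort_sorted => x y; exact: le_total.
- rewrite sorted_pairwise; last exact: ge_trans.
  rewrite pairwise_cat; apply/and3P; split.
  + by apply/allrelP => x y /nseqP[-> _]; rewrite mem_sort => /sv.
  + by elim: C => //= n ->; rewrite andbT all_nseq /= lexx orbT.
  + rewrite -sorted_pairwise; last exact: ge_trans.
    by apply: sort_sorted => x y; exact: le_total.
- by rewrite perm_sort perm_catC perm_cat2l perm_sym perm_sort.
Qed.

End Deterministic.

(** * The hard instances: batches at geometrically growing levels *)

Section Batches.
Variables (R : realType) (C : nat) (L q : R).
Hypotheses (L0 : 0 < L) (q1 : 1 <= q).

(** Levels are numbered from 0, so there are [k + 1] batches. Each instance is a prefix of the next,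
    hence earlier decisions persist. *)
Fixpoint batches (k : nat) : seq R :=
  (if k is k'.+1 then batches k' else [::]) ++ nseq C (L * q ^+ k).

Lemma level_gt0 k : 0 < L * q ^+ k.
Proof. by rewrite mulr_gt0 // exprn_gt0 // (lt_le_trans ltr01). Qed.

Lemma level_homo j k : (j <= k)%N -> L * q ^+ j <= L * q ^+ k.
Proof. by move=> jk; rewrite ler_pM2l // ler_weXn2l. Qed.

Lemma batches_itv k : {in batches k, forall v, L <= v <= L * q ^+ k}.
Proof.
elim: k => [|k ih] v; first by move=> /nseqP[-> _]; rewrite expr0 mulr1 lexx.
rewrite mem_cat => /orP[/ih /andP[-> /le_trans->//]|/nseqP[-> _]].
  exact: level_homo.
by rewrite lexx andbT -{1}[L]mulr1 -(expr0 q) level_homo.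
Qed.

Lemma opt_welfare_batches k : opt_welfare C (batches k) = C%:R * (L * q ^+ k).
Proof.
case: k => [|k]; rewrite opt_welfare_cat_nseq // => v /batches_itv/andP[_ h].
by rewrite (le_trans h) // level_homo.
Qed.

(* Summation by parts: a unit sold in batch j adds L q^j to the welfare. *)
Lemma sold_batches p k : (sold C p (batches k))%:R =
  (1 - q^-1) * (\sum_(j < k) alg_welfare C p (batches j) / (L * q ^+ j))
  + alg_welfare C p (batches k) / (L * q ^+ k).
Proof.
have q0 : q != 0 by rewrite gt_eqF // (lt_le_trans ltr01).
have L_neq0 : L != 0 by rewrite gt_eqF.
elim: k => [|k ih].
  rewrite big_ord0 mulr0 add0r /= -[nseq C _]cat0s alg_welfare_nseq /sold /=.
  by rewrite {1}/alg_welfare big_ord0 add0r subr0 expr0 mulr1 mulrAC divff // mul1r.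
rewrite big_ord_recr /= alg_welfare_nseq ih exprS.
have qk0 : q ^+ k != 0 by rewrite expf_neq0.
by field; rewrite q0 L_neq0 qk0.
Qed.

End Batches.

Lemma weighted_welfare_le (R : realType) (C : nat) (L q : R) p k :
  0 < L -> 1 <= q ->
  (1 - q^-1) * (\sum_(j < k) alg_welfare C p (batches C L q j) / (L * q ^+ j))
  + alg_welfare C p (batches C L q k) / (L * q ^+ k) <= C%:R.
Proof. by move=> L0 q1; rewrite -sold_batches // ler_nat sold_le. Qed.

(** * From the inequality on batches to the bound on the ratio *)

(** Since [n x / (n + x) = x - x^2 / (n + x)], the gap to the limit [x] is below [x^2 / n] when
    [x > 0]. *)
Lemma archimedean_limit (R : realType) (x a : R) : 0 <= x ->
  (forall n : nat, (0 < n)%N -> 1 + n%:R * (x / (n%:R + x)) <= a) -> 1 + x <= a.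
Proof.
move=> x0 h; rewrite leNgt; apply/negP => ax.
have d0 : 0 < 1 + x - a by rewrite subr_gt0.
pose n := (Num.truncn (x ^+ 2 / (1 + x - a))).+1.
have hn : x ^+ 2 < n%:R * (1 + x - a).
  by rewrite -ltr_pdivrMr // truncnS_gt.
have n0 : 0 < n%:R :> R by rewrite ltr0n.
have := h n isT; rewrite mulrA -lerBrDl ler_pdivrMr ?ltr_wpDr // => ?.
(* The last inequality yields [n (1 + x - a) <= (a - 1) x <= x^2], against [hn]. *)
nra.
Qed.

(** [W] is abstract so that the welfare of one deterministic algorithm and an expected welfare are
    treated alike. *)
Lemma competitive_ratio_ge (R : realType) (C : nat) (L U : R) (W : seq R -> R) :
  (0 < C)%N -> 0 < L -> L <= U ->
  (forall I, instances L U I -> 0 <= W I) ->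
  (forall (q : R) k, 1 <= q -> L * q ^+ k <= U ->
    (1 - q^-1) * (\sum_(j < k) W (batches C L q j) / (L * q ^+ j))
    + W (batches C L q k) / (L * q ^+ k) <= C%:R) ->
  ((1 + ln (U / L))%:E <= competitive_ratio C L U (fun I => (W I)%:E))%E.
Proof.
move=> C0 L0 LU W0 hW; set al := competitive_ratio _ _ _ _.
have U0 : 0 < U by exact: lt_le_trans LU.
have th1 : 1 <= U / L by rewrite ler_pdivlMr // mul1r.
set x := ln (U / L); have x0 : 0 <= x by exact: ln_ge0.
have CR0 : 0 < C%:R :> R by rewrite ltr0n.
have inst (q : R) k : 1 <= q -> L * q ^+ k <= U -> instances L U (batches C L q k).
  move=> q1 qU; split.
    by rewrite -size_eq0; case: (k) => [|k'];
      rewrite /= ?size_cat size_nseq ?addn_eq0 (gtn_eqF C0) ?andbF.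
  by move=> v /(batches_itv L0 q1) /andP[-> /le_trans->].
have ratio I : instances L U I -> ((opt_welfare C I)%:E / (W I)%:E <= al)%E.
  by move=> hI; apply: ereal_sup_ubound; exists I.
have opt_le (q : R) k r : 1 <= q -> L * q ^+ k <= U -> al = r%:E ->
    0 <= r /\ C%:R * (L * q ^+ k) <= r * W (batches C L q k).
  move=> q1 qU alr; have hI := inst _ _ q1 qU.
  have := ratio _ hI; rewrite alr opt_welfare_batches //.
  have l0 : 0 < C%:R * (L * q ^+ k) by rewrite mulr_gt0 // level_gt0.
  (* Zero welfare would make the ratio [+oo], contradicting the finiteness of [al]. *)
  have := W0 _ hI; rewrite le_eqVlt => /predU1P[<-|Wp].
    by rewrite inve0 gt0_muley ?lte_fin // leye_eq.
  rewrite inver gt_eqF // -EFinM lee_fin => h; split; last by rewrite -ler_pdivrMr.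
  by apply: le_trans h; rewrite divr_ge0 // ltW.
case E : al => [r| |]; last 2 first.
- exact: leey.
(* The value [-oo] is excluded by the single batch at level [L], whose ratio is either finite or
   [+oo]. *)
- have := ratio _ (inst 1 0%N (lexx _) _); rewrite expr0 mulr1 E => /(_ LU).
  rewrite opt_welfare_batches // expr0 mulr1.
  by rewrite inver; case: ifP => _; rewrite ?gt0_muley ?lte_fin ?mulr_gt0 // -EFinM leeNy_eq.
rewrite lee_fin; apply: archimedean_limit => // n n0.
have nR0 : 0 < n%:R :> R by rewrite ltr0n.
(* With this [q], [n] steps lead from [L] exactly to [U]. *)
set q := expR (x / n%:R).
have q1 : 1 <= q by rewrite -expR0 ler_expR divr_ge0.
have q0 : 0 < q by exact: expR_gt0.
have qn : L * q ^+ n = U.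
  rewrite -expRM_natl -[n%:R * _]mulrC divfK ?gt_eqF // lnK ?posrE ?divr_gt0 //.
  by rewrite mulrC divfK // gt_eqF.
have qU k : (k <= n)%N -> L * q ^+ k <= U by rewrite -qn; exact: level_homo.
have [r0 _] := opt_le q n r q1 (qU _ (leqnn _)) E.
have term k : (k <= n)%N -> C%:R <= r * (W (batches C L q k) / (L * q ^+ k)).
  move=> kn; rewrite mulrA ler_pdivlMr ?level_gt0 //.
  by have [] := opt_le q k r q1 (qU _ kn) E.
(* [e^(-t) <= 1 / (1 + t)] at [t = x / n] *)
have bound : x / (n%:R + x) <= 1 - q^-1.
  have : 1 + x / n%:R <= q by exact: expR_ge1Dx.
  have nx0 : 0 < n%:R + x by rewrite ltr_wpDr.
  have -> : 1 + x / n%:R = (n%:R + x) / n%:R by rewrite mulrDl divff // gt_eqF.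
  rewrite -lef_pV2 ?posrE ?divr_gt0 // invf_div => h.
  have -> : x / (n%:R + x) = 1 - n%:R / (n%:R + x).
    by field; exact: lt0r_neq0.
  by rewrite lerD2l lerN2.
have q'0 : 0 <= 1 - q^-1 by rewrite subr_ge0 invf_le1.
apply: (@le_trans _ _ (1 + n%:R * (1 - q^-1))).
  by rewrite lerD2l ler_pM2l.
(* After multiplying [hW] by [r], each of the [n + 1] normalised welfares is at least [C] by [term]:
   [n] of them carry weight [1 - q^-1], the last one weight 1. *)
rewrite -(ler_pM2r CR0) (le_trans _ (ler_wpM2l r0 (hW q n q1 (qU _ (leqnn _))))) //.
rewrite [leRHS]mulrDr [leLHS]mulrDl mul1r addrC lerD ?term //.
rewrite [leRHS]mulrCA [n%:R * _]mulrC -mulrA ler_wpM2l // mulr_sumr.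
rewrite mulr_natl -[X in _ *+ X]card_ord -sumr_const.
by apply: ler_sum => i _; rewrite term // ltnW.
Qed.

(** * Measurability and expectation for randomized algorithms *)

Section Randomized.
Variables (R : realType) (C : nat) (d : measure_display).
Variables (Omega : measurableType d) (P : probability Omega R).
Variables (A : Omega -> det_algorithm R) (mA : random_algorithm A).

(** Induction on [I] from an arbitrary history [x]. For fixed [x] the capacity test is
    deterministic, and the measurable event [A w x <= v] chooses between two continuations. *)
Lemma measurable_decisions (f : seq bool -> R) (I : seq R) :
  measurable_fun setT (fun w => f (decisions C (A w) I)).
Proof.
rewrite /decisions; move: [::] => x; elim: I x => [|v I ih] x /=.
  exact: measurable_cst.
pose g b w := f (foldl (fun x v => rcons x ((A w x <= v) && (count id x < C)%N))
  (rcons x b) I).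
have mb : measurable_fun setT (fun w => A w x <= v).
  by apply: measurable_realfun.measurable_fun_ler; [exact: mA|exact: measurable_cst].
case: ltnP => _; last first.
  by under eq_fun do rewrite andbF; exact: (ih (rcons x false)).
rewrite [X in measurable_fun _ X](_ : _ =
    (fun w => if A w x <= v then g true w else g false w)).
  apply: measurable_fun_ifT => //; [exact: (ih (rcons x true))|exact: (ih (rcons x false))].
by apply/funext => w; rewrite andbT /g; case: (_ <= v).
Qed.

Lemma measurable_alg_welfare I :
  measurable_fun setT (fun w => alg_welfare C (A w) I).
Proof.
exact: (measurable_decisions
  (fun x => \sum_(n < size I) nth 0 I n * (nth false x n)%:R) I).
Qed.

Lemma alg_welfare_integrable I :
  P.-integrable setT (EFin \o (fun w => alg_welfare C (A w) I)).
Proof.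
apply: measurable_bounded_integrable => //.
- by rewrite -ge0_fin_numE ?fin_num_measure.
- exact: measurable_alg_welfare.
- exists (\sum_(n < size I) `|nth 0 I n|); split; first exact: num_real.
  by move=> M /ltW bM w _; exact: le_trans (alg_welfare_norm_le _ _ _) bM.
Qed.

Let W I : R := \int[P]_w alg_welfare C (A w) I.

Let integrable_scaled I (c : R) :
  P.-integrable setT (EFin \o (fun w => c * alg_welfare C (A w) I)).
Proof. exact: (integrableZl measurableT c (alg_welfare_integrable I)). Qed.

(** Integrability is carried along in the induction because additivity of the integral requires it
    for the partial sum. *)
Lemma mean_weighted_welfare (I : nat -> seq R) (c : nat -> R) k :
  P.-integrable setT
    (EFin \o (fun w => \sum_(j < k) c j * alg_welfare C (A w) (I j))) /\
  \int[P]_w (\sum_(j < k) c j * alg_welfare C (A w) (I j)) =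
    \sum_(j < k) c j * W (I j).
Proof.
rewrite /W; elim: k => [|k [ihi ihE]].
  under eq_fun do rewrite big_ord0; rewrite big_ord0 Rintegral_cst // mul0r.
  by split=> //; exact: integrable0.
under eq_fun do rewrite big_ord_recr /=.
rewrite big_ord_recr /= RintegralD //.
rewrite ihE RintegralZl //; last exact: alg_welfare_integrable.
by split=> //; exact: (integrableD measurableT ihi (integrable_scaled _ _)).
Qed.

Lemma mean_weighted_welfare_le (L q : R) k : 0 < L -> 1 <= q ->
  (1 - q^-1) * (\sum_(j < k) W (batches C L q j) / (L * q ^+ j))
  + W (batches C L q k) / (L * q ^+ k) <= C%:R.
Proof.
move=> L0 q1.
(* One coefficient sequence absorbs the separate last term. [E] holds for every [V], hence for the
   mean and for each single run. *)
pose c j := (if j == k then 1 else 1 - q^-1) / (L * q ^+ j).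
have E (V : seq R -> R) :
    (1 - q^-1) * (\sum_(j < k) V (batches C L q j) / (L * q ^+ j))
    + V (batches C L q k) / (L * q ^+ k)
  = \sum_(j < k.+1) c j * V (batches C L q j).
  rewrite big_ord_recr /= /c eqxx mul1r [_^-1 * _]mulrC; congr (_ + _).
  rewrite mulr_sumr; apply: eq_bigr => j _.
  by rewrite ltn_eqF ?ltn_ord // [V _ / _]mulrC mulrA.
have [ic mc] := mean_weighted_welfare (batches C L q) c k.+1.
rewrite (E W) -mc.
have -> : C%:R = \int[P]_w C%:R :> R.
  by rewrite Rintegral_cst //= probability_setT mulr1.
apply: le_Rintegral => //.
  exact: finite_measure_integrable_cst.
by move=> w _; rewrite -E weighted_welfare_le.
Qed.

End Randomized.

Theorem lemma2 (R : realType) (C : nat) (L U : R)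
    (hC : (1 <= C)%N) (hL : 0 < L) (hLU : L <= U) :
  (forall p : det_algorithm R,
     ((1 + ln (U / L))%:E <= det_competitive_ratio C L U p)%E) /\
  (forall (d : measure_display) (Omega : measurableType d)
          (P : probability Omega R) (A : Omega -> det_algorithm R),
     random_algorithm A ->
     ((1 + ln (U / L))%:E <= rand_competitive_ratio P C L U A)%E).
Proof.
have W0 p I : instances L U I -> 0 <= alg_welfare C p I.
  move=> [_ hI]; apply: alg_welfare_ge0 => v /hI /andP[Lv _].
  exact: le_trans (ltW hL) Lv.
split=> [p|d Omega P A mA].
  apply: competitive_ratio_ge => // [I|q k q1 _]; first exact: W0.
  exact: weighted_welfare_le.
rewrite /rand_competitive_ratio.
(* By integrability the expectation is finite, so it is the embedding of a real integral. *)
have -> : (fun I => 'E_P[fun w => alg_welfare C (A w) I])%E =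
    (fun I => (\int[P]_w alg_welfare C (A w) I)%:E).
  apply/funext => I; rewrite unlock /Rintegral fineK //.
  by apply: integrable_fin_num => //; exact: alg_welfare_integrable.
apply: competitive_ratio_ge => // [I hI|q k q1 _].
  by apply: Rintegral_ge0 => w _; exact: W0.
exact: mean_weighted_welfare_le.
Qed.
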